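(* Let $\Bbbk$ be an algebraically closed field of arbitrary characteristic, let $d\ge 3$ and $n\ge d+4$, and suppose that $(W_{d,n})_{\mathrm{red}}$ has precisely two irreducible components, namely $V_{d,n}$ and $Y_{d,n}$. Then no multi-homogeneous polynomial on $(\mathbb{P}^d)^n$ that vanishes on $V_{d,n}$ but does not vanish identically on $Y_{d,n}$ is $\mathrm{SL}_{d+1}$-invariant (for the diagonal action of $\mathrm{SL}_{d+1}$). In particular, the polynomials needed to cut $W_{d,n}$ down to its component $V_{d,n}$ cannot be invariant with respect to projectivities.
   Context: Notation: $[n]=\{1,\dots,n\}$, and $\binom{[n]}{m}$ is the set of subsets of $[n]$ of cardinality $m$. A rational normal curve in $\mathbb{P}^d$ is the image of the $d$-th Veronese embedding $\mathbb{P}^1\hookrightarrow\mathbb{P}^d$ up to projective automorphism. Let $U_{d,n}\subseteq(\mathbb{P}^d)^n$ be the locus of configurations $(p_1,\dots,p_n)$ of $n$ distinct points such that some rational normal curve in $\mathbb{P}^d$ contains all the $p_i$. $V_{d,n}\subseteq(\mathbb{P}^d)^n$ is the Zariski closure of $U_{d,n}$ with the reduced induced scheme structure. $Y_{d,n}\subseteq(\mathbb{P}^d)^n$ (degenerate configurations) is the closed subscheme defined by all $(d+1)\times(d+1)$ minors of the $(d+1)\times n$ matrix whose columns are the homogeneous coordinates of the $n$ factors. Definition of $W_{d,n}$. For $J=\{j_1<\dots<j_k\}$ put $S_J=\sum_{l=1}^k(j_l-l)$. First let $n=d+4$. For $K\in\binom{[d+4]}{d+1}$ let $m_K$ be the maximal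 minor, with columns indexed by $K$, of the $(d+1)\times(d+4)$ matrix of homogeneous coordinates on $(\mathbb{P}^d)^{d+4}$. For $J\in\binom{[d+4]}{3}$ put $\widehat{m}_J:=(-1)^{S_J+d+1}m_{J^c}$, where $J^c=[d+4]\setminus J$. For $I=\{i_1<\dots<i_6\}\in\binom{[d+4]}{6}$ define $$\psi_I:=\widehat m_{\{i_1,i_2,i_3\}}\widehat m_{\{i_1,i_4,i_5\}}\widehat m_{\{i_2,i_4,i_6\}}\widehat m_{\{i_3,i_5,i_6\}}-\widehat m_{\{i_1,i_2,i_4\}}\widehat m_{\{i_1,i_3,i_5\}}\widehat m_{\{i_2,i_3,i_6\}}\widehat m_{\{i_4,i_5,i_6\}}.$$ For general $n\ge d+4$ and $J\in\binom{[n]}{d+4}$, let $\pi_J:(\mathbb{P}^d)^n\to(\mathbb{P}^d)^{d+4}$, $(p_i)\mapsto(p_i)_{i\in J}$ (indices in increasing order), and $\psi_{I,J}:=\pi_J^*\psi_I$. $W_{d,n}\subseteq(\mathbb{P}^d)^n$ is the closed subscheme defined by all $\psi_{I,J}$, $I\in\binom{[d+4]}{6}$, $J\in\binom{[n]}{d+4}$. *)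

(* Defs.v *)
(* Everything is expressed on k-points: over an algebraically closed field k the
   reduced closed subschemes of (P^d)^n correspond to the Zariski-closed sets of
   k-points, so W and Y below are the closed sets underlying W_{d,n}, Y_{d,n}.
   Columns, points and coordinates are numbered from 0. *)
From HB Require Import structures.
From mathcomp Require Import all_boot all_order all_algebra.
From mathcomp Require Import mpoly.
From mathcomp Require Import boolp classical_sets.

Set Implicit Arguments.
Unset Strict Implicit.
Unset Printing Implicit Defensive.

Import GRing.Theory.
Local Open Scope ring_scope.

(* The matrix of the columns of A with index in J, in increasing order, as
   [enum J] is increasing; it is meant for #|J| = m. *)
Definition cols (R : comNzRingType) (r n m : nat) (J : {set 'I_n})
    (A : 'M[R]_(r, n)) : 'M[R]_(r, m) :=
  \matrix_(i < r, l < m) [seq A i j | j in J]`_l.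

Definition minor (R : comNzRingType) (d n : nat) (K : {set 'I_n})
    (A : 'M[R]_(d.+1, n)) : R :=
  \det (cols d.+1 K A).

(* S_J = sum_l (j_l - l): [enum_val l] is the l-th smallest element of J.
   The shift from 1-based to 0-based numbering cancels, and the truncated
   subtraction is exact. *)
Definition Ssum (n : nat) (J : {set 'I_n}) : nat :=
  (\sum_(l < #|J|) ((enum_val l : 'I_n) - l))%N.

Definition mhat (R : comNzRingType) (d : nat) (J : {set 'I_d.+4})
    (A : 'M[R]_(d.+1, d.+4)) : R :=
  (-1) ^+ (Ssum J + d.+1)%N * minor (~: J) A.

(* Meant for #|I| = 6; [i 1], ..., [i 6] are i_1 < ... < i_6. *)
Definition psi (R : comNzRingType) (d : nat) (I : {set 'I_d.+4})
    (A : 'M[R]_(d.+1, d.+4)) : R :=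
  let i (l : nat) := nth ord0 (enum I) l.-1 in
  let m a b c := mhat [set i a; i b; i c] A in
  m 1%N 2%N 3%N * m 1%N 4%N 5%N * m 2%N 4%N 6%N * m 3%N 5%N 6%N
  - m 1%N 2%N 4%N * m 1%N 3%N 5%N * m 2%N 3%N 6%N * m 4%N 5%N 6%N.

(* Polynomials in the homogeneous coordinates of (P^d)^n. The variable of index
   [mxvec_index i j] is the i-th coordinate of the j-th point. *)
Notation cpoly k d n := {mpoly k[(d.+1 * n)%N]}.

Definition coordmx (k : fieldType) (d n : nat) :
    'M[cpoly k d n]_(d.+1, n) :=
  \matrix_(i < d.+1, j < n) 'X_(mxvec_index i j).

Definition eval_at (k : fieldType) (d n : nat) (f : cpoly k d n)
    (A : 'M[k]_(d.+1, n)) : k :=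
  f.@[fun l => mxvec A 0 l].

Definition multihomog (k : fieldType) (d n : nat) (f : cpoly k d n) : Prop :=
  exists a : 'I_n -> nat, forall m, m \in msupp f ->
    forall j : 'I_n, (\sum_(i < d.+1) m (mxvec_index i j))%N = a j.

(* f(g X) = f(X) for all g in SL_{d+1}(k), where g acts on all n points. *)
Definition SL_invariant (k : fieldType) (d n : nat) (f : cpoly k d n) : Prop :=
  forall g : 'M[k]_d.+1, \det g = 1 ->
    f \mPo [tuple mxvec (map_mx (@mpolyC _ k) g *m coordmx k d n) 0 l
           | l < (d.+1 * n)%N] = f.

(* P^d as the set of lines of k^{d+1}. *)
Definition projspace (k : fieldType) (d : nat) : Type :=
  {L : {vspace 'cV[k]_d.+1} | \dim L == 1%N}.

Definition config (k : fieldType) (d n : nat) : Type := 'I_n -> projspace k d.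

Definition hcoord (k : fieldType) (d n : nat) (A : 'M[k]_(d.+1, n))
    (p : config k d n) : Prop :=
  forall j : 'I_n, <[col j A]>%VS = val (p j).

(* For multihomogeneous f this does not depend on the representative A. *)
Definition vanishes (k : fieldType) (d n : nat) (f : cpoly k d n)
    (p : config k d n) : Prop :=
  forall A : 'M[k]_(d.+1, n), hcoord A p -> eval_at f A = 0.

Definition veronese (k : fieldType) (d : nat) (x : 'cV[k]_2) : 'cV[k]_d.+1 :=
  \col_(i < d.+1) (x 0 0 ^+ (d - i)%N * x 1 0 ^+ i).

Local Open Scope classical_set_scope.

Definition zeros (k : fieldType) (d n : nat) (F : set (cpoly k d n)) :
    set (config k d n) :=
  [set p | forall f, F f -> vanishes f p].

Definition zariski_closed (k : fieldType) (d n : nat)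
    (Z : set (config k d n)) : Prop :=
  exists2 F : set (cpoly k d n), F `<=` @multihomog k d n & Z = zeros F.

Definition zariski_closure (k : fieldType) (d n : nat)
    (Z : set (config k d n)) : set (config k d n) :=
  smallest (@zariski_closed k d n) Z.

Definition zariski_irreducible (k : fieldType) (d n : nat)
    (Z : set (config k d n)) : Prop :=
  Z !=set0 /\
  forall A B, zariski_closed A -> zariski_closed B ->
    Z `<=` A `|` B -> Z `<=` A \/ Z `<=` B.

Definition irreducible_component (k : fieldType) (d n : nat)
    (X Z : set (config k d n)) : Prop :=
  [/\ zariski_closed Z, zariski_irreducible Z, Z `<=` X &
   forall Z', zariski_closed Z' -> zariski_irreducible Z' -> Z' `<=` X ->
     Z `<=` Z' -> Z' = Z].

Definition rational_normal_curve (k : fieldType) (d : nat)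
    (C : set (projspace k d)) : Prop :=
  exists2 g : 'M[k]_d.+1, g \in unitmx &
    C = [set q | exists2 x : 'cV[k]_2, x != 0 &
                 val q = <[g *m veronese d x]>%VS].

Definition U (k : fieldType) (d n : nat) : set (config k d n) :=
  [set p | injective p /\
    exists2 C, rational_normal_curve C & forall j, C (p j)].

Definition V (k : fieldType) (d n : nat) : set (config k d n) :=
  zariski_closure (@U k d n).

Definition Y (k : fieldType) (d n : nat) : set (config k d n) :=
  zeros [set f | exists2 K : {set 'I_n}, #|K| = d.+1 &
                 f = minor K (coordmx k d n)].

(* psi_{I,J} = pi_J^* psi_I is psi_I on the columns of index in J. *)
Definition W (k : fieldType) (d n : nat) : set (config k d n) :=
  zeros [set f | exists (I : {set 'I_d.+4}) (J : {set 'I_n}),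
                 [/\ #|I| = 6%N, #|J| = d.+4 &
                  f = psi I (cols d.+4 J (coordmx k d n))]].

Arguments U k d n _ : clear implicits.
Arguments V k d n _ : clear implicits.
Arguments Y k d n _ : clear implicits.
Arguments W k d n _ : clear implicits.

(* Main.v *)
Require Import Defs.
From mathcomp Require Import all_boot all_order all_algebra.
From mathcomp Require Import mpoly.
From mathcomp Require Import boolp classical_sets.

(** Degenerate configurations are unstable for SL_{d+1}: if A has rank at most d
    and t is nonzero, the one-parameter subgroup diag(t, ..., t, t^-d), written
    in a basis whose first d vectors span a space containing the columns of A,
    has determinant 1 and multiplies A by t ([SL_contraction]). A
    multihomogeneous invariant f of total degree D thus satisfies
    f(A) = f(t A) = t^D f(A) for every nonzero t, so f(A) = 0 when D > 0; when
    D = 0, f is a constant. Hence an invariant with a single zero, in particular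
    one that vanishes on the nonempty set V, vanishes on all matrices of rank at
    most d ([SL_invariant_vanishes_on_degenerate]); by [row_free_minor], the
    coordinate matrices of the points of Y are among them. This argument avoids
    the first fundamental theorem of invariant theory, which would write f as a
    polynomial in the maximal minors.

    For the last assertion, if all equations in F vanished on Y, then Y would
    lie in the intersection of W with the zeros of F, that is in V; as Y is a
    component of W and V is an irreducible closed subset of W, this would force
    V = Y. *)

Section Instability.
Set Implicit Arguments.
Unset Strict Implicit.
Import GRing.Theory.
Local Open Scope ring_scope.

Lemma eval_minor (k : fieldType) (d n : nat) (K : {set 'I_n})
    (A : 'M[k]_(d.+1, n)) (hK : #|K| = d.+1) :
  eval_at (minor K (coordmx k d n)) A = minor K A.
Proof.
rewrite /eval_at /minor -det_map_mx; congr (\det _).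
apply/matrixP => i l; rewrite !mxE.
have hl : (l < size (enum K))%N by rewrite -cardE hK.
have [j0 _] : exists j0 : 'I_n, j0 \in K by apply/card_gt0P; rewrite hK.
by rewrite !(nth_map j0) // mxE /= mevalXU mxvecE.
Qed.

(** The d+1 independent columns chosen by [fullrankfun] come in no particular
    order, whereas [cols] sorts them; so invertibility is obtained from the span
    of the selected columns instead of an equality of matrices. *)
Lemma row_free_minor (k : fieldType) (d n : nat) (A : 'M[k]_(d.+1, n)) :
  row_free A -> exists2 K : {set 'I_n}, #|K| = d.+1 & minor K A != 0.
Proof.
rewrite /row_free -mxrank_tr -[_ == _]/(row_full A^T) => fullA.
pose h := fullrankfun fullA.
have hK : #|[set h x | x in [set: 'I_d.+1]]| = d.+1.
  by rewrite card_imset ?cardsT ?card_ord //; exact: fullrankfun_inj.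
exists [set h x | x in [set: 'I_d.+1]] => //; set K := imset _ _ in hK *.
rewrite /minor -unitfE -unitmxE -unitmx_tr -row_full_unit -sub1mx.
have := fullrowsub_full fullA; rewrite -sub1mx => /submx_trans; apply.
apply/row_subP => x.
have xK : h x \in enum K by rewrite mem_enum imset_f.
have lt_x : (index (h x) (enum K) < d.+1)%N.
  by rewrite -[ltnRHS]hK cardE index_mem.
have -> : row x (rowsub h A^T) = row (Ordinal lt_x) (cols d.+1 K A)^T.
  by apply/rowP => i; rewrite !mxE (nth_map (h x)) ?index_mem // nth_index.
exact: row_sub.
Qed.

(** In the factorization A = L * pid_mx r * R with r = \rank A <= d, the last
    diagonal entry of diag(t, ..., t, t^-d) only meets the zero last row of
    pid_mx r, so conjugating this diagonal matrix by L gives g. *)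
Lemma SL_contraction (k : fieldType) (d n : nat) (A : 'M[k]_(d.+1, n))
    (rkA : ~~ row_free A) (t : k) (ht : t != 0) :
  exists2 g : 'M[k]_d.+1, \det g = 1 & g *m A = t *: A.
Proof.
have {rkA} ltA : (\rank A < d.+1)%N.
  by move: rkA; rewrite /row_free ltn_neqAle rank_leq_row andbT.
pose w : 'rV[k]_d.+1 := \row_i (if i == ord_max then t ^- d else t).
pose L := col_ebase A; have uL : L \in unitmx := col_ebase_unit A.
exists (L *m diag_mx w *m invmx L).
  rewrite !det_mulmx det_inv mulrC mulrA mulVr -?unitmxE // mul1r det_diag.
  rewrite big_ord_recr /= mxE eqxx.
  rewrite (eq_bigr (fun=> t)) => [|i _]; last first.
    by rewrite mxE; case: eqP => // /(congr1 val) /= hi; have := ltn_ord i;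
       rewrite hi ltnn.
  by rewrite prodr_const card_ord divff // expf_neq0.
rewrite -{1}(mulmx_ebase A) -/L -!mulmxA mulKmx // !mulmxA -(mulmxA L).
suff -> : diag_mx w *m pid_mx (\rank A) = t *: pid_mx (\rank A) :> 'M_(_, n).
  by rewrite -scalemxAr -scalemxAl mulmx_ebase.
apply/matrixP => i j; rewrite mul_diag_mx !mxE.
case: eqP => // ->; case: eqP => [/= _|_]; last by rewrite !mulr0.
by rewrite ltnNge -ltnS ltA !mulr0.
Qed.

Lemma eval_SL_invariant (k : fieldType) (d n : nat) (f : cpoly k d n)
    (g : 'M[k]_d.+1) (A : 'M[k]_(d.+1, n)) :
  SL_invariant f -> \det g = 1 -> eval_at f (g *m A) = eval_at f A.
Proof.
move=> finv /finv {2}<-; rewrite /eval_at comp_mpoly_meval.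
apply: meval_eq => l; rewrite tnth_mktuple.
case/mxvec_indexP: l => i j; rewrite !mxvecE !mxE raddf_sum /=.
by apply: eq_bigr => m _; rewrite !mxE mevalM mevalC mevalXU mxvecE.
Qed.

Lemma eval_scale (k : fieldType) (d n : nat) (f : cpoly k d n) :
  multihomog f ->
  exists D : nat, forall (t : k) A, eval_at f (t *: A) = t ^+ D * eval_at f A.
Proof.
move=> [a fa]; pose D := (\sum_j a j)%N; exists D => t A.
rewrite /eval_at !mevalE mulr_sumr !big_seq; apply: eq_bigr => m /fa ma.
rewrite mulrCA; congr (_ * _).
have <- : mdeg m = D.
  rewrite mdegE (reindex _ (curry_mxvec_bij _ _)) /=.
  transitivity (\sum_(p : 'I_d.+1 * 'I_n) m (mxvec_index p.1 p.2))%N.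
    by apply: eq_bigr => -[].
  rewrite -(pair_bigA _ (fun i j => m (mxvec_index i j))) exchange_big /=.
  by apply: eq_bigr => j _; rewrite ma.
rewrite mdegE expr_sum -big_split /=; apply: eq_bigr => l _.
by rewrite linearZ mxE exprMn.
Qed.

(** A root of X^(D+2) - X - 1 works in every characteristic: it is nonzero, and
    t^(D+1) = 1 would turn the equation into t = t + 1. *)
Lemma closed_field_non_root_of_unity (k : closedFieldType) (D : nat) :
  exists2 t : k, t != 0 & t ^+ D.+1 != 1.
Proof.
have [t] := @solve_monicpoly k D.+2 (fun i => (i <= 1)%:R) isT.
rewrite 2!big_ord_recl big1 => [|i _]; last by rewrite mul0r.
rewrite /= !mul1r expr0 expr1 addr0 => ht; exists t.
  by apply/eqP => t0; move/eqP: ht; rewrite t0 expr0n addr0 eq_sym oner_eq0.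
apply/eqP => t1; move/eqP: ht.
by rewrite exprS t1 mulr1 -subr_eq0 opprD addrCA subrr addr0 oppr_eq0 oner_eq0.
Qed.

Lemma exists_hcoord (k : fieldType) (d n : nat) (p : config k d n) :
  exists A, hcoord A p.
Proof.
have line (j : 'I_n) : exists v, <[v]>%VS = val (p j).
  exists (vpick (val (p j))); apply/eqP; rewrite eqEdim -memvE memv_pick.
  by rewrite dim_vline vpick0 -dimv_eq0 (eqP (valP (p j))).
have [v hv] := boolp.choice line.
exists (\matrix_(i, j) v j i 0) => j; rewrite -hv; congr <[_]>%VS.
by apply/colP => i; rewrite !mxE.
Qed.

Lemma SL_invariant_vanishes_on_degenerate (k : closedFieldType) (d n : nat)
    (f : cpoly k d n) (A0 A : 'M[k]_(d.+1, n)) :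
  multihomog f -> SL_invariant f -> eval_at f A0 = 0 -> ~~ row_free A ->
  eval_at f A = 0.
Proof.
move=> /eval_scale [D fD] finv fA0 rkA.
case: D fD => [|D] fD.
  (* In degree 0, both values of f are equal to its value at the matrix 0. *)
  by rewrite -fA0 -[LHS]mul1r -[RHS]mul1r -(expr0 0) -!fD !scale0r.
have [t t0 /eqP tD] := closed_field_non_root_of_unity k D.
have [g g1 gA] := SL_contraction rkA t0.
have /eqP := eval_SL_invariant A finv g1.
rewrite gA fD -subr_eq0 -{2}[eval_at f A]mul1r -mulrBl mulf_eq0 subr_eq0.
by case/orP => /eqP.
Qed.

End Instability.

Local Open Scope classical_set_scope.

Theorem mainTheorem7 (k : closedFieldType) (d n : nat)
    (hd : (3 <= d)%N) (hn : (d + 4 <= n)%N)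
    (hVY : V k d n <> Y k d n)
    (hW : forall Z : set (config k d n),
        irreducible_component (W k d n) Z <-> Z = V k d n \/ Z = Y k d n) :
  (forall f : cpoly k d n, multihomog f ->
     (forall p, V k d n p -> vanishes f p) ->
     ~ (forall p, Y k d n p -> vanishes f p) ->
     ~ SL_invariant f)
  /\
  (forall F : set (cpoly k d n), F `<=` @multihomog k d n ->
     W k d n `&` zeros F = V k d n ->
     exists f, [/\ F f, ~ (forall p, Y k d n p -> vanishes f p)
                 & ~ SL_invariant f]).
Proof.
have [Vcl Virr VW _] := (hW (V k d n)).2 (or_introl erefl).
have [_ _ YW Ymax] := (hW (Y k d n)).2 (or_intror erefl).
have noninv (f : cpoly k d n) : multihomog f ->
    (forall p, V k d n p -> vanishes f p) ->
    ~ (forall p, Y k d n p -> vanishes f p) -> ~ SL_invariant f.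
  move=> fh fV fY finv; apply: fY => p Yp A hA.
  have [[q Vq] _] := Virr; have [A0 hA0] := exists_hcoord q.
  apply: (SL_invariant_vanishes_on_degenerate fh finv (fV _ Vq _ hA0)).
  apply/negP => /row_free_minor [K hK /eqP]; apply.
  by rewrite -eval_minor //; apply: Yp hA; exists K.
split=> // F Fh FV.
have [f Ff fY] : exists2 f, F f & ~ (forall p, Y k d n p -> vanishes f p).
  apply: contrapT => noF; apply: hVY; apply: Ymax => //.
  rewrite -FV => p Yp; split; first exact: YW.
  move=> f Ff; apply: contrapT => nfp; apply: noF; exists f => // fY.
  by apply: nfp; exact: fY.
exists f; split=> //; apply: noninv => //; first exact: Fh.
by move=> p; rewrite -FV => -[_]; apply.
Qed.
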